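(* Let $K$ be a field, let $H=\langle n_1,n_2,n_3\rangle$ be a non-symmetric numerical semigroup minimally generated by three elements $n_1,n_2,n_3$ (not necessarily listed increasingly), and let $R=K[H]$. Let $a_i,b_i$ ($i=1,2,3$) be the positive integers attached to $(n_1,n_2,n_3)$ by the minimal relations $$c_1n_1=b_2n_2+a_3n_3,\qquad c_2n_2=a_1n_1+b_3n_3,\qquad c_3n_3=b_1n_1+a_2n_2$$ described in the context, and set $d_i=\min\{a_i,b_i\}$ for $1\le i\le 3$. Then $$\operatorname{tr}(\omega_R)=(t^{d_1n_1},t^{d_2n_2},t^{d_3n_3})R \quad\text{and}\quad \operatorname{res}(H)=d_1d_2d_3 .$$
   Context: A numerical semigroup $H$ is a submonoid of $(\mathbb{N},+)$ (with $0\in\mathbb{N}$) such that $\mathbb{N}\setminus H$ is finite. $M=H\setminus\{0\}$; $F(H)$ is the largest integer not in $H$; $PF(H)=\{f\in\mathbb{N}\setminus H: f+M\subseteq H\}$. $H$ is symmetric if for all $x\in\mathbb{Z}$ either $x\in H$ or $F(H)-x\in H$. $K[H]=K[t^h:h\in H]\subseteq K[t]$ is the semigroup ring. Its canonical module $\omega_{K[H]}$ is the fractional $K[H]$-ideal generated by $t^{-f}$, $f\in PF(H)$. For an $R$-module $N$ the trace is $\operatorname{tr}(N)=\sum_{\varphi\in \operatorname{Hom}_R(N,R)}\varphi(N)$; for $R=K[H]$ one has $\operatorname{tr}(\omega_R)=\omega_R\cdot\omega_R^{-1}$, where $\omega_R^{-1}=\{x\in K(t): x\,\omega_R\subseteq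 R\}$. The residue of $H$ is $\operatorname{res}(H)=\dim_K K[H]/\operatorname{tr}(\omega_{K[H]})$. Minimal relations: for $H=\langle n_1,n_2,n_3\rangle$ non-symmetric and minimally generated by three elements, let $c_1,c_2,c_3$ be the smallest positive integers such that there exist nonnegative integers $a_i,b_i$ with $c_1n_1=b_2n_2+a_3n_3$, $c_2n_2=a_1n_1+b_3n_3$, $c_3n_3=b_1n_1+a_2n_2$ (that is, $c_i$ is the least positive integer with $c_in_i$ in the semigroup generated by the other two generators). It is known (Herzog) that these $a_i,b_i$ are then uniquely determined and positive, and that $c_i=a_i+b_i$ for $i=1,2,3$. *)

(* Defs.v *)
From HB Require Import structures.
From mathcomp Require Import all_boot all_order all_algebra.
From mathcomp Require Import all_classical.
Set Implicit Arguments.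
Unset Strict Implicit.
Unset Printing Implicit Defensive.
Import Order.TTheory GRing.Theory Num.Theory.
Local Open Scope classical_set_scope.
Local Open Scope ring_scope.

Section NumericalSemigroups.
Implicit Types (H G : set nat).

Definition submonoid H : Prop :=
  H 0%N /\ forall x y, H x -> H y -> H (x + y)%N.

Definition numerical_semigroup H : Prop := submonoid H /\ finite_set (~` H).

Definition monoid_span G : set nat := smallest submonoid G.

Definition minimally_generates G H : Prop :=
  monoid_span G = H /\ forall G', G' `<` G -> monoid_span G' <> H.

Definition pseudo_frobenius H : set nat :=
  [set f | ~ H f /\ forall m, H m -> m <> 0%N -> H (f + m)%N].

Definition int_mem H (x : int) : Prop := exists2 h : nat, H h & x = h%:Z.

(* The largest integer outside H; it is -1 when H is all of nat. *)
Definition is_frobenius H (F : int) : Prop :=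
  ~ int_mem H F /\ forall x : int, ~ int_mem H x -> x <= F.

Definition symmetric_semigroup H : Prop :=
  exists2 F : int, is_frobenius H F &
    forall x : int, int_mem H x \/ int_mem H (F - x).

Definition least_multiple (c n : nat) G : Prop :=
  [/\ (0 < c)%N, monoid_span G (c * n)%N &
      forall c' : nat, (0 < c')%N -> monoid_span G (c' * n)%N -> (c <= c')%N].

End NumericalSemigroups.

(* Every ring and module below is a subset of the field K(t). *)
Notation ratfun K := {fraction {poly K}}.

Section Modules.
Variable K : fieldType.
Local Notation L := (ratfun K).
Implicit Types (R N V W : set L).

Definition tvar : L := tofrac 'X.

Definition kconst (c : K) : L := tofrac c%:P.

Definition semigroup_ring (H : set nat) : set L :=
  @tofrac _ @` smallest (fun A : set {poly K} => GRing.subalg_closed (mem A))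
                     [set 'X^h | h in H].

Definition submodule R N : Prop :=
  [/\ N 0, forall x y, N x -> N y -> N (x + y) &
      forall r x, R r -> N x -> N (r * x)].

Definition module_span R (G : set L) : set L := smallest (submodule R) G.

(* A homomorphism from N to R is represented by a map on K(t) of which only the
   values on N are constrained, and only those values are used in [trace]. *)
Definition is_hom R N (phi : L -> L) : Prop :=
  [/\ forall x, N x -> R (phi x),
      forall x y, N x -> N y -> phi (x + y) = phi x + phi y &
      forall r x, R r -> N x -> phi (r * x) = r * phi x].

Definition trace R N : set L :=
  module_span R (\bigcup_(phi in is_hom R N) (phi @` N)).

Definition canonical_module (H : set nat) : set L :=
  module_span (semigroup_ring H) [set tvar ^- f | f in pseudo_frobenius H].

(* dim_K (V / W) = n for K-subspaces W of V: the classes of v_0, ..., v_(n-1)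
   form a basis of V / W. *)
Definition quotient_dim V W (n : nat) : Prop :=
  exists v : 'I_n -> L,
  [/\ forall i, V (v i),
      forall c : 'I_n -> K,
        W (\sum_(i < n) kconst (c i) * v i) -> forall i, c i = 0 &
      forall x, V x ->
        exists c : 'I_n -> K, W (x - \sum_(i < n) kconst (c i) * v i)].

Definition residue (H : set nat) (n : nat) : Prop :=
  quotient_dim (semigroup_ring H)
    (trace (semigroup_ring H) (canonical_module H)) n.

End Modules.

Arguments tvar {K}.
Arguments semigroup_ring : clear implicits.
Arguments canonical_module : clear implicits.
Arguments residue : clear implicits.

(* Main.v *)
(** The trace is spanned by the monomials t^s with s in
    T = { s | exists f in PF(H), forall f' in PF(H), s + f - f' in H }.  Since H
    is not symmetric, no two of the c_i n_i coincide, which makes all the a_i and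
    b_i positive and gives c_i = a_i + b_i.  The two pseudo-Frobenius numbers are
    then c2 n2 + a3 n3 - N and b2 n2 + c3 n3 - N with N = n1 + n2 + n3, and their
    difference is a1 n1 - b2 n2 = a2 n2 - b3 n3 = a3 n3 - b1 n1.  This puts every
    a_i n_i and b_i n_i in T.  Conversely a factorization (x1, x2, x3) with all
    x_i < d_i stays the only one of its value after adding a1 to x1 or b2 to x2,
    so its value is not in T; these d1 d2 d3 distinct values form H \ T. *)

Require Import Defs.
From HB Require Import structures.
From mathcomp Require Import all_boot all_order all_algebra.
From mathcomp Require Import all_classical.
From mathcomp Require Import zify.
Set Implicit Arguments.
Unset Strict Implicit.
Unset Printing Implicit Defensive.
Import Order.TTheory GRing.Theory Num.Theory.
Local Open Scope classical_set_scope.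
Local Open Scope ring_scope.

(** * Factorizations over three generators and the minimal relations *)

Section Combinatorics.
Local Open Scope nat_scope.

(* [x n = x' n + (y' - y) p + (z' - z) q] forces [c <= x - x'], with both sides
   moved so that no truncated subtraction occurs. *)
Definition minimal_coef (c n p q : nat) : Prop :=
  forall x y z x' y' z', x' < x -> y <= y' -> z <= z' ->
    x * n + y * p + z * q = x' * n + y' * p + z' * q -> c + x' <= x.

(** The relations follow the cyclic pattern c_i n_i = b_(i+1) n_(i+1) + a_(i+2) n_(i+2). Hence a
    fact about one index passes to the others by rotation, and a transposition of generators, which
    reverses the orientation, exchanges the a's and the b's. *)
Record herzog (n1 n2 n3 a1 a2 a3 b1 b2 b3 c1 c2 c3 : nat) : Prop := Herzog {
  n1_gt0 : 0 < n1; n2_gt0 : 0 < n2; n3_gt0 : 0 < n3;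
  c1_gt0 : 0 < c1; c2_gt0 : 0 < c2; c3_gt0 : 0 < c3;
  c1_min : minimal_coef c1 n1 n2 n3;
  c2_min : minimal_coef c2 n2 n3 n1;
  c3_min : minimal_coef c3 n3 n1 n2;
  c1_rel : c1 * n1 = b2 * n2 + a3 * n3;
  c2_rel : c2 * n2 = b3 * n3 + a1 * n1;
  c3_rel : c3 * n3 = b1 * n1 + a2 * n2 }.

Lemma minimal_coefC c n p q : minimal_coef c n p q -> minimal_coef c n q p.
Proof.
by move=> H x y z x' y' z' ltx ley lez E; apply: (H x z y x' z' y') => //; lia.
Qed.

Lemma herzog_rot n1 n2 n3 a1 a2 a3 b1 b2 b3 c1 c2 c3 :
  herzog n1 n2 n3 a1 a2 a3 b1 b2 b3 c1 c2 c3 ->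
  herzog n2 n3 n1 a2 a3 a1 b2 b3 b1 c2 c3 c1.
Proof. by case=> *; split. Qed.

Lemma herzog_swap n1 n2 n3 a1 a2 a3 b1 b2 b3 c1 c2 c3 :
  herzog n1 n2 n3 a1 a2 a3 b1 b2 b3 c1 c2 c3 ->
  herzog n1 n3 n2 b1 b3 b2 a1 a3 a2 c1 c3 c2.
Proof. by case=> *; split=> //; first [exact: minimal_coefC | lia]. Qed.

Lemma dominated_eq n1 n2 n3 x1 x2 x3 y1 y2 y3 :
  0 < n1 -> 0 < n2 -> 0 < n3 -> x1 <= y1 -> x2 <= y2 -> x3 <= y3 ->
  x1 * n1 + x2 * n2 + x3 * n3 = y1 * n1 + y2 * n2 + y3 * n3 ->
  x1 = y1 /\ x2 = y2 /\ x3 = y3.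
Proof.
move=> p1 p2 p3 le1 le2 le3 E.
have m1 : x1 * n1 <= y1 * n1 by rewrite leq_mul2r le1 orbT.
have m2 : x2 * n2 <= y2 * n2 by rewrite leq_mul2r le2 orbT.
have m3 : x3 * n3 <= y3 * n3 by rewrite leq_mul2r le3 orbT.
do 2?split; apply/eqP.
- by rewrite -(eqn_pmul2r p1); apply/eqP; lia.
- by rewrite -(eqn_pmul2r p2); apply/eqP; lia.
- by rewrite -(eqn_pmul2r p3); apply/eqP; lia.
Qed.

Lemma leq_exists_addn m n : m <= n -> exists k, n = m + k.
Proof. by exists (n - m); rewrite subnKC. Qed.

(* If all three products were distinct, [b2 = 0] would propagate around the
   relations: [c1 n1 = a3 n3 > c3 n3 = a2 n2 > c2 n2 = a1 n1 >= c1 n1]. *)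
Lemma coef_eq0_coincidence n1 n2 n3 a1 a2 a3 b1 b2 b3 c1 c2 c3 :
  herzog n1 n2 n3 a1 a2 a3 b1 b2 b3 c1 c2 c3 -> b2 = 0 ->
  [\/ c1 * n1 = c2 * n2, c2 * n2 = c3 * n3 | c3 * n3 = c1 * n1].
Proof.
case=> p1 p2 p3 q1 q2 q3 m1 m2 m3 r1 r2 r3 z2.
have dom := dominated_eq p1 p2 p3.
have a3_gt0 : 0 < a3.
  by case: (posnP a3) => // z3; have := dom 0 0 0 c1 0 0; lia.
have le3 : c3 <= a3 by have := m3 a3 0 0 0 c1 0; lia.
have [|ne3] := eqVneq a3 c3; first by move=> e; subst; constructor 3; lia.
(* The third relation turns c1 n1 = a3 n3 into c1 n1 = b1 n1 + a2 n2 + k3 n3 with k3 > 0. This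
   excludes c1 <= b1, and then minimality of c1 leaves only b1 = 0. The same argument is repeated
   below for b3. *)
have [k3 e3] := leq_exists_addn le3.
have b1_lt : b1 < c1.
  by rewrite ltnNge; apply/negP => le1; have := dom c1 0 0 b1 a2 k3; subst; lia.
have z1 : b1 = 0 by have := m1 c1 0 0 b1 a2 k3; subst; lia.
have a2_gt0 : 0 < a2.
  by case: (posnP a2) => // z; have := dom 0 0 0 0 0 c3; subst; lia.
have le2 : c2 <= a2 by have := m2 a2 0 0 0 c3 0; subst; lia.
have [|ne2] := eqVneq a2 c2; first by move=> e; subst; constructor 2; lia.
have [k2 e2] := leq_exists_addn le2.
have b3_lt : b3 < c3.
  by rewrite ltnNge; apply/negP => le; have := dom 0 0 c3 a1 k2 b3; subst; lia.
have z3 : b3 = 0 by have := m3 c3 0 0 b3 a1 k2; subst; lia.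
have a1_gt0 : 0 < a1.
  by case: (posnP a1) => // z; have := dom 0 0 0 0 c2 0; subst; lia.
have le1 : c1 <= a1 by have := m1 a1 0 0 0 c2 0; subst; lia.
have := dom c1 0 0 a1 k2 k3.
have [k1 e1] := leq_exists_addn le1.
subst; lia.
Qed.

(** Rotations and the swap carry the case b2 = 0 to the vanishing of any of the six coefficients. *)
Lemma herzog_coef_gt0 n1 n2 n3 a1 a2 a3 b1 b2 b3 c1 c2 c3 :
  herzog n1 n2 n3 a1 a2 a3 b1 b2 b3 c1 c2 c3 ->
  c1 * n1 <> c2 * n2 -> c2 * n2 <> c3 * n3 -> c3 * n3 <> c1 * n1 ->
  [/\ 0 < a1, 0 < a2 & 0 < a3] /\ [/\ 0 < b1, 0 < b2 & 0 < b3].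
Proof.
move=> h1 ne12 ne23 ne31.
have h2 := herzog_rot h1; have h3 := herzog_rot h2.
have H1 := coef_eq0_coincidence h1; have H2 := coef_eq0_coincidence h2.
have H3 := coef_eq0_coincidence h3.
have H1' := coef_eq0_coincidence (herzog_swap h1).
have H2' := coef_eq0_coincidence (herzog_swap h2).
have H3' := coef_eq0_coincidence (herzog_swap h3).
split; split; rewrite lt0n; apply/eqP.
- by case/H2'; lia.
- by case/H3'; lia.
- by case/H1'; lia.
- by case/H3; lia.
- by case/H1; lia.
- by case/H2; lia.
Qed.

(** If b2 = c2 + k, the second relation turns the first into c1 n1 = a1 n1 + k n2 + (a3 + b3) n3,
    which contradicts minimality of c1 when a1 < c1 and positivity otherwise. *)
Lemma herzog_b2_lt n1 n2 n3 a1 a2 a3 b1 b2 b3 c1 c2 c3 :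
  herzog n1 n2 n3 a1 a2 a3 b1 b2 b3 c1 c2 c3 ->
  0 < a1 -> 0 < a3 -> b2 < c2.
Proof.
case=> p1 p2 p3 q1 q2 q3 m1 m2 m3 r1 r2 r3 a1_gt0 a3_gt0.
have dom := dominated_eq p1 p2 p3.
rewrite ltnNge; apply/negP => /leq_exists_addn[k e].
case: (leqP c1 a1) => [le1|lt1].
  by have := dom c1 0 0 a1 k (a3 + b3); subst; lia.
by have := m1 c1 0 0 a1 k (a3 + b3); subst; lia.
Qed.

(** The sum of the three relations gives two factorizations of one value. If they differed, some
    coordinate would move strictly against the other two, hence by at least c_i. But 0 < a_i + b_i <
    2 c_i keeps a_i + b_i at distance less than c_i from c_i. *)
Lemma herzog_coefD n1 n2 n3 a1 a2 a3 b1 b2 b3 c1 c2 c3 :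
  herzog n1 n2 n3 a1 a2 a3 b1 b2 b3 c1 c2 c3 ->
  [/\ 0 < a1, 0 < a2 & 0 < a3] -> [/\ 0 < b1, 0 < b2 & 0 < b3] ->
  c1 = a1 + b1 /\ c2 = a2 + b2 /\ c3 = a3 + b3.
Proof.
move=> h1 [x1 x2 x3] [y1 y2 y3].
have h2 := herzog_rot h1; have h3 := herzog_rot h2.
have l1 := herzog_b2_lt h1 x1 x3; have l2 := herzog_b2_lt h2 x2 x1.
have l3 := herzog_b2_lt h3 x3 x2.
have k1 := herzog_b2_lt (herzog_swap h1) y1 y2.
have k2 := herzog_b2_lt (herzog_swap h2) y2 y3.
have k3 := herzog_b2_lt (herzog_swap h3) y3 y1.
case: h1 => p1 p2 p3 q1 q2 q3 m1 m2 m3 r1 r2 r3 {h2 h3}.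
have E : c1 * n1 + c2 * n2 + c3 * n3 =
  (a1 + b1) * n1 + (a2 + b2) * n2 + (a3 + b3) * n3 by lia.
have {r1 r2 r3} := E.
move: (leqP c1 (a1 + b1)) (leqP c2 (a2 + b2)) (leqP c3 (a3 + b3)).
move=> [] u1 [] u2 [] u3 e.
- exact: (dominated_eq p1 p2 p3 u1 u2 u3 e).
- by have := m3 c3 c1 c2 _ _ _ u3 u1 u2; lia.
- by have := m2 c2 c3 c1 _ _ _ u2 u3 u1; lia.
- case: (ltngtP c1 (a1 + b1)) => [w|w|w]; [|lia|].
    by have := m1 _ _ _ c1 c2 c3 w (ltnW u2) (ltnW u3); lia.
  by have := dominated_eq p1 p2 p3 (eq_leq (esym w)) (ltnW u2) (ltnW u3)
    (esym e); lia.
- by have := m1 c1 c2 c3 _ _ _ u1 u2 u3; lia.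
- case: (ltngtP c2 (a2 + b2)) => [w|w|w]; [|lia|].
    by have := m2 _ _ _ c2 c3 c1 w (ltnW u3) (ltnW u1); lia.
  by have := dominated_eq p1 p2 p3 (ltnW u1) (eq_leq (esym w)) (ltnW u3)
    (esym e); lia.
- case: (ltngtP c3 (a3 + b3)) => [w|w|w]; [|lia|].
    by have := m3 _ _ _ c3 c1 c2 w (ltnW u1) (ltnW u2); lia.
  by have := dominated_eq p1 p2 p3 (ltnW u1) (ltnW u2) (eq_leq (esym w))
    (esym e); lia.
by have := dominated_eq p1 p2 p3 (ltnW u1) (ltnW u2) (ltnW u3) (esym e); lia.
Qed.

(** Minimality of c1 gives y1 = c1 + x1 + k, so c1 n1 can be traded for b2 n2 + a3 n3 inside y. The
    result still has first coordinate at least x1. Comparing it with x gives the last alternative,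
    or one of the first two by minimality of c2 or c3. *)
Lemma two_factorizations_swing n1 n2 n3 a1 a2 a3 b1 b2 b3 c1 c2 c3
    x1 x2 x3 y1 y2 y3 :
  herzog n1 n2 n3 a1 a2 a3 b1 b2 b3 c1 c2 c3 ->
  x1 < y1 -> y2 <= x2 -> y3 <= x3 ->
  x1 * n1 + x2 * n2 + x3 * n3 = y1 * n1 + y2 * n2 + y3 * n3 ->
  c2 <= x2 \/ c3 <= x3 \/ (b2 <= x2 /\ a3 <= x3).
Proof.
case=> p1 p2 p3 q1 q2 q3 m1 m2 m3 r1 r2 r3 lt1 le2 le3 E.
have dom := dominated_eq p1 p2 p3.
have : c1 + x1 <= y1 by apply: (m1 y1 y2 y3 x1 x2 x3) => //; lia.
move=> /leq_exists_addn[k e]; subst y1.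
case: (leqP (b2 + y2) x2) => l2; case: (leqP (a3 + y3) x3) => l3.
- by lia.
- have := m2 x2 x3 x1 (b2 + y2) (a3 + y3) (x1 + k).
  by have := dom x1 x2 x3 (x1 + k) (b2 + y2) (a3 + y3); lia.
- have := m3 x3 x1 x2 (a3 + y3) (x1 + k) (b2 + y2).
  by have := dom x1 x2 x3 (x1 + k) (b2 + y2) (a3 + y3); lia.
by have := dom x1 x2 x3 (x1 + k) (b2 + y2) (a3 + y3); lia.
Qed.

(* A factorization that is divisible by neither monomial of any of the three
   binomials [x1^c1 - x2^b2 x3^a3], ... is the only one of its value. *)
Lemma two_factorizations n1 n2 n3 a1 a2 a3 b1 b2 b3 c1 c2 c3 x1 x2 x3 y1 y2 y3 :
  herzog n1 n2 n3 a1 a2 a3 b1 b2 b3 c1 c2 c3 ->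
  x1 * n1 + x2 * n2 + x3 * n3 = y1 * n1 + y2 * n2 + y3 * n3 ->
  (x1 = y1 /\ x2 = y2 /\ x3 = y3) \/
  (c1 <= x1 \/ c2 <= x2 \/ c3 <= x3) \/
  (b2 <= x2 /\ a3 <= x3) \/ (b3 <= x3 /\ a1 <= x1) \/ (b1 <= x1 /\ a2 <= x2).
Proof.
move=> h1 E; have h2 := herzog_rot h1; have h3 := herzog_rot h2.
have s1 := two_factorizations_swing h1; have s2 := two_factorizations_swing h2.
have s3 := two_factorizations_swing h3.
case: h1 => p1 p2 p3 _ _ _ m1 m2 m3 _ _ _.
have dom := dominated_eq p1 p2 p3.
move: (leqP x1 y1) (leqP x2 y2) (leqP x3 y3) => [] u1 [] u2 [] u3.
- by left; apply: dom.
- by have := m3 _ _ _ _ _ _ u3 u1 u2; lia.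
- by have := m2 _ _ _ _ _ _ u2 u3 u1; lia.
- case: (ltngtP x1 y1) => [w|w|w]; [|lia|].
    by have := s1 _ _ _ _ _ _ w (ltnW u2) (ltnW u3) E; lia.
  by have := dom _ _ _ _ _ _ (eq_leq (esym w)) (ltnW u2) (ltnW u3) (esym E);
    lia.
- by have := m1 _ _ _ _ _ _ u1 u2 u3; lia.
- case: (ltngtP x2 y2) => [w|w|w]; [|lia|].
    by have := s2 _ _ _ _ _ _ w (ltnW u3) (ltnW u1); lia.
  by have := dom _ _ _ _ _ _ (ltnW u1) (eq_leq (esym w)) (ltnW u3) (esym E);
    lia.
- case: (ltngtP x3 y3) => [w|w|w]; [|lia|].
    by have := s3 _ _ _ _ _ _ w (ltnW u1) (ltnW u2); lia.
  by have := dom _ _ _ _ _ _ (ltnW u1) (ltnW u2) (eq_leq (esym w)) (esym E);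
    lia.
by have := dom _ _ _ _ _ _ (ltnW u1) (ltnW u2) (ltnW u3) (esym E); lia.
Qed.

(** * The semigroup as a set of combinations of its generators *)

Definition combinations (n1 n2 n3 : nat) : set nat :=
  [set x | exists x1 x2 x3, x = x1 * n1 + x2 * n2 + x3 * n3].

Lemma combinationsE n1 n2 n3 x1 x2 x3 :
  combinations n1 n2 n3 (x1 * n1 + x2 * n2 + x3 * n3).
Proof. by exists x1, x2, x3. Qed.

Lemma combinations_rot n1 n2 n3 : combinations n1 n2 n3 = combinations n2 n3 n1.
Proof.
by apply/seteqP; split=> x [x1 [x2 [x3 ->]]];
  [exists x2, x3, x1 | exists x3, x1, x2]; lia.
Qed.

Lemma combinations_swap n1 n2 n3 :
  combinations n1 n2 n3 = combinations n1 n3 n2.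
Proof.
by apply/seteqP; split=> x [x1 [x2 [x3 ->]]]; exists x1, x3, x2; lia.
Qed.

Lemma submonoid_combinations n1 n2 n3 : submonoid (combinations n1 n2 n3).
Proof.
split; first by exists 0, 0, 0.
move=> x y [x1 [x2 [x3 ->]]] [y1 [y2 [y3 ->]]].
by exists (x1 + y1), (x2 + y2), (x3 + y3); lia.
Qed.

Lemma submonoid_mul (G : set nat) k x : submonoid G -> G x -> G (k * x).
Proof.
by move=> [G0 GD] Gx; elim: k => [//|k IHk]; rewrite mulSn; apply: GD.
Qed.

Lemma monoid_span3 n1 n2 n3 :
  monoid_span [set n1; n2; n3] = combinations n1 n2 n3.
Proof.
apply/seteqP; split.
  apply: smallest_sub; first exact: submonoid_combinations.
  by move=> x [[->|->]|->]; [exists 1, 0, 0|exists 0, 1, 0|exists 0, 0, 1]; lia.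
move=> _ [x1 [x2 [x3 ->]]] G [Gm sG].
have G1 : G n1 by apply: sG; left; left.
have G2 : G n2 by apply: sG; left; right.
have G3 : G n3 by apply: sG; right.
by case: (Gm) => _ GD; do 2?apply: (GD); apply: submonoid_mul.
Qed.

Lemma monoid_span2 p q :
  monoid_span [set p; q] = [set x | exists y z, x = y * p + z * q].
Proof.
apply/seteqP; split.
  apply: smallest_sub => [|x [->|->]]; last 2 first.
  - by exists 1, 0; lia.
  - by exists 0, 1; lia.
  split; first by exists 0, 0.
  move=> _ _ [x1 [x2 ->]] [y1 [y2 ->]].
  by exists (x1 + y1), (x2 + y2); lia.
move=> _ [y [z ->]] G [Gm sG].
have Gp : G p by apply: sG; left.
have Gq : G q by apply: sG; right.
by case: (Gm) => _ GD; apply: (GD); apply: submonoid_mul.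
Qed.

Lemma least_multiple_minimal c n p q :
  least_multiple c n [set p; q] -> minimal_coef c n p q.
Proof.
move=> [c_gt0 _ cmin] x y z x' y' z' ltx /leq_exists_addn[k ->]
  /leq_exists_addn[l ->] E.
have [d e] := leq_exists_addn (ltnW ltx); subst x.
have d_gt0 : 0 < d by lia.
have := cmin d d_gt0; rewrite monoid_span2 => /(_ _)/[dup].
have : exists y0 z0, d * n = y0 * p + z0 * q by exists k, l; lia.
by move=> hd /(_ hd); lia.
Qed.

(** A zero generator could be dropped without changing the span; distinctness makes the remaining
    pair a proper subset. *)
Lemma minimally_generates_gt0 n1 n2 n3 (H : set nat) :
  uniq [:: n1; n2; n3] -> minimally_generates [set n1; n2; n3] H ->
  [/\ 0 < n1, 0 < n2 & 0 < n3].
Proof.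
rewrite /= !inE negb_or => /and3P[/andP[ne12 ne13] ne23 _] [HE Hmin].
have drop p q r : [set n1; n2; n3] = [set p; q; r] ->
    p != q -> p != r -> 0 < p.
  move=> E /eqP pq /eqP pr; case: (posnP p) => // p0.
  case: (Hmin [set q; r]); last first.
    rewrite -HE E monoid_span3 monoid_span2; apply/seteqP; split=> x.
      by move=> [y [z ->]]; exists 0, y, z; lia.
    by move=> [x1 [x2 [x3 ->]]]; exists x2, x3; lia.
  rewrite E; split; first by move=> x [->|->]; [left; right|right].
  by move=> /(_ p) /= [] //; left; left.
split.
- exact: (drop n1 n2 n3).
- apply: (drop n2 n1 n3) => //; last by rewrite eq_sym.
  by congr (_ `|` _); rewrite setUC.
- apply: (drop n3 n1 n2); rewrite 1?eq_sym //.
  by rewrite setUC setUA.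
Qed.

(** * A coincidence c_i n_i = c_j n_j forces symmetry *)

Lemma cofinite_bound (H : set nat) :
  finite_set (~` H) -> exists B, forall m, B <= m -> H m.
Proof.
move=> /finite_seqP[s sE]; exists (\max_(i <- s) i).+1 => m lem.
apply: contrapT => nHm.
have : m \in s by have : (~` H) m by []; rewrite sE.
by move=> ms; have := @leq_bigmax_seq _ s xpredT id m ms erefl; lia.
Qed.

(* Every integer is [u n1 + k n2 + v n3] with [u < c1], [k < c2] and [v] in Z,
   and it lies in the semigroup exactly when [0 <= v].  The symmetry sends
   [(u, k, v)] to [(c1 - 1 - u, c2 - 1 - k, -1 - v)]. *)
Lemma coincidence_symmetric n1 n2 n3 a1 a2 a3 b1 b2 b3 c1 c2 c3 :
  herzog n1 n2 n3 a1 a2 a3 b1 b2 b3 c1 c2 c3 ->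
  finite_set (~` combinations n1 n2 n3) -> c3 * n3 = c1 * n1 ->
  symmetric_semigroup (combinations n1 n2 n3).
Proof.
case=> p1 p2 p3 q1 q2 q3 m1 m2 m3 _ r2 _ cofin /esym r13.
have dom := dominated_eq p1 p2 p3.
have [B HB] := cofinite_bound cofin.
have normal (x : int) : exists (u k : nat) (v : int),
    [/\ u < c1, k < c2 & x = ((u * n1 + k * n2)%N%:Z + v * n3%:Z)%R].
  (* A large multiple of n3 moves x past B, where everything has a factorization; it is subtracted
     again in v. *)
  have [m [mE mB]] : exists m : nat, (x + (B + absz x)%N%:Z * n3%:Z = m%:Z)%R
    /\ B <= m.
    by exists (absz (x + (B + absz x)%N%:Z * n3%:Z)%R); nia.
  have [x1 [x2 [x3 E]]] := HB m mB.
  (* First each c2 n2 is traded for b3 n3 + a1 n1, then each c1 n1 for c3 n3; the remainders are k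
     and u. *)
  have e2 := divn_eq x2 c2; have e1 := divn_eq (x1 + x2 %/ c2 * a1) c1.
  have l2 := ltn_pmod x2 q2; have l1 := ltn_pmod (x1 + x2 %/ c2 * a1) q1.
  move: l1 l2 e1 e2; set u := _ %% c1; set w := _ %/ c1; set k := _ %% c2.
  set t := _ %/ c2 => l1 l2 e1 e2.
  exists u, k, ((x3 + t * b3 + w * c3)%N%:Z - (B + absz x)%N%:Z)%R; split=> //.
  have X1 : (x1 + t * a1) * n1 = u * n1 + w * (c3 * n3) by rewrite e1 -r13; lia.
  have X2 : x2 * n2 = k * n2 + t * (b3 * n3 + a1 * n1) by rewrite -r2 {1}e2;
    lia.
  by lia.
have memP (u k : nat) (v : int) : u < c1 -> k < c2 ->
    int_mem (combinations n1 n2 n3) ((u * n1 + k * n2)%N%:Z + v * n3%:Z)%R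
      <-> (0 <= v)%R.
  move=> ltu ltk; split; last first.
    by move=> v0; exists (u * n1 + k * n2 + absz v * n3);
      [exists u, k, (absz v)|lia].
  move=> [m [p [q [r ->]]]] E; rewrite leNgt; apply/negP => v_lt0.
  have [w [w0 wE]] : exists w : nat, 0 < w /\ v = (- w%:Z)%R by exists (absz v);
    lia.
  subst v; have {}E : u * n1 + k * n2 + 0 * n3 = p * n1 + q * n2 + (r + w) * n3
    by lia.
  have [leq|ltq] := leqP q k; last first.
    have [ltu'|leu] := ltnP p u;
      first by have := m1 _ _ _ _ _ _ ltu' (ltnW ltq) (leq0n (r + w)) E; lia.
    by have := dom _ _ _ _ _ _ leu (ltnW ltq) (leq0n (r + w)) E; lia.
  have [ltu'|leu] := ltnP p u; last first.
    case: (ltngtP q k) leq => // [lt _|eqk _].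
      by have := m2 k 0 u q (r + w) p lt; lia.
    by have := dom u k 0 p q (r + w); lia.
  (* Here p < u and q <= k, so c3 <= r + w by minimality. Trading c3 n3 for c1 n1 raises the first
     coordinate to p + c1 > u, and the previous comparison applies again. *)
  have := m3 (r + w) p q 0 u k.
  have [/leq_exists_addn[y Ey]|lt] :=
    leqP c3 (r + w); last lia.
  have [Eu|] := leqP u (p + c1); last lia.
  move=> _; case: (ltngtP q k) leq => // [lt _|eqk _].
    by have := m2 k 0 u q y (p + c1); lia.
  by have := dom u k 0 (p + c1) q y; lia.
(* The largest integer with v < 0 has u and k maximal and v = -1. *)
exists ((c1.-1 * n1 + c2.-1 * n2)%N%:Z + (-1) * n3%:Z)%R.
  split; first by rewrite memP; lia.
  move=> x; have [u [k [v [ltu ltk ->]]]] := normal x.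
  rewrite memP // => /negP; rewrite -ltNge => v0.
  have : u * n1 <= c1.-1 * n1 by rewrite leq_mul2r; lia.
  have : k * n2 <= c2.-1 * n2 by rewrite leq_mul2r; lia.
  by nia.
move=> x; have [u [k [v [ltu ltk ->]]]] := normal x.
rewrite memP //; case: (lerP 0 v) => v0; [by left | right].
have -> : ((c1.-1 * n1 + c2.-1 * n2)%N%:Z + (-1) * n3%:Z
     - ((u * n1 + k * n2)%N%:Z + v * n3%:Z)
   = ((c1.-1 - u) * n1 + (c2.-1 - k) * n2)%N%:Z + (-1 - v) * n3%:Z)%R.
  have [d1 e1] : exists d, c1.-1 = u + d by apply: leq_exists_addn; lia.
  have [d2 e2] : exists d, c2.-1 = k + d by apply: leq_exists_addn; lia.
  by rewrite e1 e2 !addKn; lia.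
by rewrite memP; lia.
Qed.

(** * The pseudo-Frobenius numbers *)

(** The first coordinates differ by less than c, so minimality forbids a strict move against the
    second coordinate. The generator absent from the equation enters [dominated_eq] as 1 with
    coefficient 0. *)
Lemma two_factorizations_edge c n p q x y x' y' :
  minimal_coef c n p q -> 0 < n -> 0 < p -> x < c + x' -> x' < c + x ->
  x * n + y * p = x' * n + y' * p -> x = x' /\ y = y'.
Proof.
move=> m n_gt0 p_gt0 l1 l2 E.
have dom a b a' b' := @dominated_eq n p 1 a b 0 a' b' 0 n_gt0 p_gt0 isT.
case: (leqP x x') => l; case: (leqP y y') => l'.
- by have := dom _ _ _ _ l l' isT; lia.
- case: (ltngtP x x') l => // [w _|w _].
    by have := m x' y' 0 x y 0 w; lia.
  by have := dom x' y' x y; lia.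
- by have := m x y 0 x' y' 0 l l' isT; lia.
by have := dom x' y' x y; lia.
Qed.

Section PseudoFrobenius.
Variables (n1 n2 n3 a1 a2 a3 b1 b2 b3 c1 c2 c3 : nat).
Hypothesis h : herzog n1 n2 n3 a1 a2 a3 b1 b2 b3 c1 c2 c3.
Hypotheses (a_gt0 : [/\ 0 < a1, 0 < a2 & 0 < a3])
           (b_gt0 : [/\ 0 < b1, 0 < b2 & 0 < b3]).

(** Cancelling the common multiple of n3 leaves a multiple of n1 or of n2 alone on one side. The
    bounds force that multiple to be c1 or c2, and the other side is then the corresponding minimal
    relation. *)
Lemma faces_exchange p q p' q' :
  0 < p -> 0 < q -> 0 < p' -> 0 < q' -> p <= c2 -> p' <= c1 ->
  p * n2 + q * n3 = p' * n1 + q' * n3 ->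
  (p = b2 /\ p' = c1 /\ q = q' + a3) \/ (p = c2 /\ p' = a1 /\ q' = q + b3).
Proof using h a_gt0 b_gt0.
have [C1 [C2 C3]] := herzog_coefD h a_gt0 b_gt0.
case: h a_gt0 b_gt0 => p1 p2 p3 _ _ _ m1 m2 m3 r1 r2 r3 [A1 A2 A3] [B1 B2 B3].
move=> P Q P' Q' le2 le1 E.
case: (leqP q' q) => [/leq_exists_addn[k e]|/ltnW/leq_exists_addn[k e]]; subst.
  have E1 : p' = a1 + b1 by have := m1 p' 0 0 0 p k; lia.
  subst p'; left; have := two_factorizations_edge (x := p) (y := k) (x' := b2)
    (y' := a3) m2 p2 p3.
  by lia.
have E1 : p = a2 + b2 by have := m2 p 0 0 0 k p'; lia.
subst p; right; have := two_factorizations_edge (x := p') (y := k) (x' := a1)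
  (y' := b3) (minimal_coefC m1) p1 p3.
by lia.
Qed.

(** Exceeding a bound would allow one trade along a relation, of c2 n2, of c3 n3, or of b2 n2 + a3
    n3, leaving all three coordinates positive. *)
Lemma face_bound (s p q : nat) :
  (forall u v w, 0 < u -> 0 < v -> 0 < w -> s <> u * n1 + v * n2 + w * n3) ->
  s = p * n2 + q * n3 -> 0 < p -> 0 < q ->
  [/\ p <= c2, q <= c3 & p <= b2 \/ q <= a3].
Proof using h a_gt0 b_gt0.
have [C1 [C2 C3]] := herzog_coefD h a_gt0 b_gt0.
case: h a_gt0 b_gt0 => p1 p2 p3 q1 _ _ m1 m2 m3 r1 r2 r3 [A1 A2 A3] [B1 B2 B3].
move=> nofull E P Q; split.
- rewrite leqNgt; apply/negP => lt; have [k e] := leq_exists_addn (ltnW lt).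
  by apply: (nofull a1 k (q + b3)); subst; lia.
- rewrite leqNgt; apply/negP => lt; have [k e] := leq_exists_addn (ltnW lt).
  by apply: (nofull b1 (p + a2) k); subst; lia.
case: (leqP p b2) => [|lt]; first by left.
right; rewrite leqNgt; apply/negP => lt'.
have [k e] := leq_exists_addn (ltnW lt);
  have [l e'] := leq_exists_addn (ltnW lt').
by apply: (nofull c1 k l); subst; lia.
Qed.
End PseudoFrobenius.

(** This says that b2 n2 + c3 n3 - (n1 + n2 + n3) is not in the semigroup; the swap covers the other
    candidate. In the main case v <= b2 and w <= c3, u is at least c1, and trading c1 n1 gives a
    factorization that minimality of c3 or domination rules out. *)
Lemma no_interior_factorization n1 n2 n3 a1 a2 a3 b1 b2 b3 c1 c2 c3 u v w :
  herzog n1 n2 n3 a1 a2 a3 b1 b2 b3 c1 c2 c3 ->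
  [/\ 0 < a1, 0 < a2 & 0 < a3] -> [/\ 0 < b1, 0 < b2 & 0 < b3] ->
  0 < u -> 0 < v -> 0 < w ->
  b2 * n2 + c3 * n3 <> u * n1 + v * n2 + w * n3.
Proof.
move=> h a_gt0 b_gt0; have [C1 [C2 C3]] := herzog_coefD h a_gt0 b_gt0.
case: h a_gt0 b_gt0 => p1 p2 p3 _ _ _ m1 m2 m3 r1 r2 r3 [A1 A2 A3] [B1 B2 B3].
move=> U V W E; have dom := dominated_eq p1 p2 p3.
case: (leqP v b2) => lv; case: (leqP w c3) => lw.
- have : c1 <= u by have := m1 u v w 0 b2 c3; lia.
  move=> /leq_exists_addn[k e]; subst u.
  have [lt|le] := ltnP (w + a3) c3.
    by have := m3 c3 0 b2 (w + a3) k (v + b2) lt; lia.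
  by have := dom 0 b2 c3 k (v + b2) (w + a3); lia.
- case: (ltngtP v b2) lv => // [lt|e] _.
    by have := m2 b2 c3 0 v w u lt; lia.
  by have := dom 0 b2 c3 u v w; lia.
- case: (ltngtP w c3) lw => // [lt|e] _.
    by have := m3 c3 0 b2 w u v lt; lia.
  by have := dom 0 b2 c3 u v w; lia.
by have := dom 0 b2 c3 u v w; lia.
Qed.

(* [g] is pseudo-Frobenius iff [g + n1 + n2 + n3] has a factorization with
   support exactly each pair of coordinates but none with full support. *)
Lemma pseudo_frobenius_herzog n1 n2 n3 a1 a2 a3 b1 b2 b3 c1 c2 c3 g :
  herzog n1 n2 n3 a1 a2 a3 b1 b2 b3 c1 c2 c3 ->
  [/\ 0 < a1, 0 < a2 & 0 < a3] -> [/\ 0 < b1, 0 < b2 & 0 < b3] ->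
  pseudo_frobenius (combinations n1 n2 n3) g <->
  g + (n1 + n2 + n3) = a3 * n3 + c2 * n2 \/
  g + (n1 + n2 + n3) = b2 * n2 + c3 * n3.
Proof.
move=> h a_gt0 b_gt0; have [C1 [C2 C3]] := herzog_coefD h a_gt0 b_gt0.
have sa_gt0 : [/\ 0 < b1, 0 < b3 & 0 < b2] by case: b_gt0.
have sb_gt0 : [/\ 0 < a1, 0 < a3 & 0 < a2] by case: a_gt0.
have h' := herzog_swap h.
have [p1 p2 p3] : [/\ 0 < n1, 0 < n2 & 0 < n3] by case: h.
split=> [[ng gH]|].
  have nofull u v w : 0 < u -> 0 < v -> 0 < w ->
      g + (n1 + n2 + n3) <> u * n1 + v * n2 + w * n3.
    move=> U V W E; apply: ng; exists u.-1, v.-1, w.-1.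
    by case: u v w U V W E => [|u] [|v] [|w]; lia.
  (* A factorization of g + n1 with n2 + n3 added has positive second and third coordinates, so its
     first one vanishes by [nofull]. The next two facts are analogous. *)
  have sE : exists p q,
      [/\ 0 < p, 0 < q & g + (n1 + n2 + n3) = p * n2 + q * n3].
    have [||x1 [x2 [x3 E]]] := gH n1; first by exists 1, 0, 0; lia.
      by lia.
    by exists x2.+1, x3.+1; case: x1 E => [|x1] E;
      [split; lia|case: (nofull x1.+1 x2.+1 x3.+1); lia].
  have sE' : exists p q,
      [/\ 0 < p, 0 < q & g + (n1 + n2 + n3) = p * n1 + q * n3].
    have [||x1 [x2 [x3 E]]] := gH n2; first by exists 0, 1, 0; lia.
      by lia.
    by exists x1.+1, x3.+1; case: x2 E => [|x2] E;
      [split; lia|case: (nofull x1.+1 x2.+1 x3.+1); lia].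
  have sE'' : exists p q,
      [/\ 0 < p, 0 < q & g + (n1 + n2 + n3) = p * n1 + q * n2].
    have [||x1 [x2 [x3 E]]] := gH n3; first by exists 0, 0, 1; lia.
      by lia.
    by exists x1.+1, x2.+1; case: x3 E => [|x3] E;
      [split; lia|case: (nofull x1.+1 x2.+1 x3.+1); lia].
  have [p [q [P Q E]]] := sE; have [p' [q' [P' Q' E']]] := sE'.
  have [p'' [q'' [P'' Q'' E'']]] := sE''.
  have [lp lq lpq] := face_bound h a_gt0 b_gt0 nofull E P Q.
  have [_ lp' _] : [/\ q' <= c3, p' <= c1 & q' <= b3 \/ p' <= a1].
    apply: (face_bound (herzog_rot h) _ _ (s := g + (n1 + n2 + n3))) => //;
      last by lia.
    - by case: a_gt0.
    - by case: b_gt0.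
    by move=> u v w U V W; have := nofull w u v W U V; lia.
  have [lp'' _ _] : [/\ p'' <= c1, q'' <= c2 & p'' <= b1 \/ q'' <= a2].
    apply: (face_bound (herzog_rot (herzog_rot h)) _ _
      (s := g + (n1 + n2 + n3))) => //.
    - by case: a_gt0.
    - by case: b_gt0.
    by move=> u v w U V W; have := nofull v w u V W U; lia.
  have X1 := faces_exchange h a_gt0 b_gt0 P Q P' Q' lp lp'.
  have X2 := faces_exchange h' sa_gt0 sb_gt0 Q P P'' Q'' lq lp''.
  have {}X1 := X1 ltac:(lia); have {}X2 := X2 ltac:(lia).
  (* Now p is b2 or c2 and q is a3 or c3. The pair (b2, a3) would give q' = 0, and (c2, c3) violates
     [lpq]. *)
  case: X1 => [[e1 [e2 e3]]|[e1 [e2 e3]]];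
    case: X2 => [[f1 [f2 f3]]|[f1 [f2 f3]]].
  - by lia.
  - by right; rewrite E e1 f1.
  - by left; rewrite E e1 f1; lia.
  - by case: a_gt0 b_gt0 => ? ? ? [? ? ?]; exfalso; lia.
have vertex u v w : 0 < u -> 0 < v -> 0 < w ->
    a3 * n3 + c2 * n2 <> u * n1 + v * n2 + w * n3 /\
    b2 * n2 + c3 * n3 <> u * n1 + v * n2 + w * n3.
  move=> U V W; split; last exact: (no_interior_factorization h).
  by have := no_interior_factorization h' sa_gt0 sb_gt0 U W V; lia.
case: h a_gt0 b_gt0 => _ _ _ _ _ _ _ _ _ r1 r2 r3 [A1 A2 A3] [B1 B2 B3] gE.
split.
  move=> [x1 [x2 [x3 E]]].
  have := vertex x1.+1 x2.+1 x3.+1 isT isT isT; lia.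
have [_ Hadd] := submonoid_combinations n1 n2 n3.
have [[u1 U1] [u2 U2] [u3 U3]] :=
  And3 (leq_exists_addn A1) (leq_exists_addn A2) (leq_exists_addn A3).
have [[v1 V1] [v2 V2] [v3 V3]] :=
  And3 (leq_exists_addn B1) (leq_exists_addn B2) (leq_exists_addn B3).
(* The witnesses come from c2 n2 + a3 n3 = a1 n1 + c3 n3 = c1 n1 + a2 n2 and b2 n2 + c3 n3 = c1 n1 +
   b3 n3 = b1 n1 + c2 n2, lowering both coefficients by one. *)
have H1 : combinations n1 n2 n3 (g + n1).
  case: gE; subst.
    by exists 0, (u2 + v2).+1, u3; lia.
  by exists 0, v2, (u3 + v3).+1; lia.
have H2 : combinations n1 n2 n3 (g + n2).
  case: gE; subst.
    by exists u1, 0, (u3 + v3).+1; lia.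
  by exists (u1 + v1).+1, 0, v3; lia.
have H3 : combinations n1 n2 n3 (g + n3).
  case: gE; subst.
    by exists (u1 + v1).+1, u2, 0; lia.
  by exists v1, (u2 + v2).+1, 0; lia.
move=> _ [x1 [x2 [x3 ->]]] m_neq0.
case: x1 m_neq0 => [|x1] m_neq0; last first.
  have -> : g + (x1.+1 * n1 + x2 * n2 + x3 * n3) =
    g + n1 + (x1 * n1 + x2 * n2 + x3 * n3) by lia.
  by apply: Hadd => //; apply: combinationsE.
case: x2 m_neq0 => [|x2] m_neq0; last first.
  have -> : g + (0 * n1 + x2.+1 * n2 + x3 * n3) =
    g + n2 + (0 * n1 + x2 * n2 + x3 * n3) by lia.
  by apply: Hadd => //; apply: combinationsE.
case: x3 m_neq0 => [|x3] m_neq0 //.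
have -> : g + (0 * n1 + 0 * n2 + x3.+1 * n3) =
  g + n3 + (0 * n1 + 0 * n2 + x3 * n3) by lia.
by apply: Hadd => //; apply: combinationsE.
Qed.

(** * The exponents of the trace *)

(** Each monomial of the three binomials has some exponent at least min(a_i, b_i), so none divides a
    factorization in the box. *)
Lemma box_factorization_unique n1 n2 n3 a1 a2 a3 b1 b2 b3 c1 c2 c3
    x1 x2 x3 y1 y2 y3 :
  herzog n1 n2 n3 a1 a2 a3 b1 b2 b3 c1 c2 c3 ->
  [/\ 0 < a1, 0 < a2 & 0 < a3] -> [/\ 0 < b1, 0 < b2 & 0 < b3] ->
  x1 < minn a1 b1 -> x2 < minn a2 b2 -> x3 < minn a3 b3 ->
  x1 * n1 + x2 * n2 + x3 * n3 = y1 * n1 + y2 * n2 + y3 * n3 ->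
  x1 = y1 /\ x2 = y2 /\ x3 = y3.
Proof.
move=> h a_gt0 b_gt0 l1 l2 l3 E;
  have [C1 [C2 C3]] := herzog_coefD h a_gt0 b_gt0.
by have := two_factorizations h E; lia.
Qed.

(* The exponents of the monomials in [tr(omega) = omega omega^-1]. *)
Definition trace_exponents (H : set nat) : set nat :=
  [set s | exists2 g, pseudo_frobenius H g &
     forall g', pseudo_frobenius H g' -> exists2 m, H m & s + g = g' + m].

Lemma trace_exponents_addl H h s :
  submonoid H -> H h -> trace_exponents H s -> trace_exponents H (h + s).
Proof.
move=> [_ HD] Hh [g PFg Hg]; exists g => // g' /Hg[k Hk E].
by exists (h + k); [exact: HD | lia].
Qed.

Lemma trace_exponents_herzog n1 n2 n3 a1 a2 a3 b1 b2 b3 c1 c2 c3 :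
  herzog n1 n2 n3 a1 a2 a3 b1 b2 b3 c1 c2 c3 ->
  [/\ 0 < a1, 0 < a2 & 0 < a3] -> [/\ 0 < b1, 0 < b2 & 0 < b3] ->
  trace_exponents (combinations n1 n2 n3) =
  [set s | exists x1 x2 x3, s = x1 * n1 + x2 * n2 + x3 * n3 /\
     [\/ minn a1 b1 <= x1, minn a2 b2 <= x2 | minn a3 b3 <= x3]].
Proof.
move=> h a_gt0 b_gt0; have [C1 [C2 C3]] := herzog_coefD h a_gt0 b_gt0.
have PFE g := pseudo_frobenius_herzog g h a_gt0 b_gt0.
have two := two_factorizations h.
have [p1 p2 p3] : [/\ 0 < n1, 0 < n2 & 0 < n3] by case: h.
case: h a_gt0 b_gt0 => _ _ _ _ _ _ _ _ _ r1 r2 r3 [A1 A2 A3] [B1 B2 B3].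
have mul n x y : x <= y -> x * n <= y * n by move=> le;
  rewrite leq_mul2r le orbT.
(* The subtraction is not truncated: adding the three factorizations of the right side, one per pair
   of generators, gives three times it as the sum of the (a_i + c_i) n_i, and a_i + c_i >= 3. *)
have PFA : exists gA, gA + (n1 + n2 + n3) = a3 * n3 + c2 * n2.
  exists (a3 * n3 + c2 * n2 - (n1 + n2 + n3)); apply: subnK.
  by have := mul n1 3 (a1 + c1); have := mul n2 3 (a2 + c2);
     have := mul n3 3 (a3 + c3); subst; lia.
have PFB : exists gB, gB + (n1 + n2 + n3) = b2 * n2 + c3 * n3.
  exists (b2 * n2 + c3 * n3 - (n1 + n2 + n3)); apply: subnK.
  by have := mul n1 3 (b1 + c1); have := mul n2 3 (b2 + c2);
     have := mul n3 3 (b3 + c3); subst; lia.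
have [gA EA] := PFA; have [gB EB] := PFB.
have PA : pseudo_frobenius (combinations n1 n2 n3) gA by apply/PFE; left.
have PB : pseudo_frobenius (combinations n1 n2 n3) gB by apply/PFE; right.
apply/seteqP; split=> s.
  move=> [g Pg Hg].
  have [m [x1 [x2 [x3 em]]] E] := Hg g Pg.
  have [e1|] := leqP (minn a1 b1) x1; first by exists x1, x2, x3; split;
    [lia|constructor 1].
  have [e2|] := leqP (minn a2 b2) x2; first by exists x1, x2, x3; split;
    [lia|constructor 2].
  have [e3|] := leqP (minn a3 b3) x3; first by exists x1, x2, x3; split;
    [lia|constructor 3].
  (* As gA - gB = a1 n1 - b2 n2, membership would give s + a1 n1 or s + b2 n2 a second
     factorization, which [two_factorizations] excludes. *)
  move=> l3 l2 l1; exfalso; case/PFE: Pg => Eg.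
    have [k [y1 [y2 [y3 ek]]] E'] := Hg gB PB.
    by have := two (x1 + a1) x2 x3 y1 (y2 + b2) y3; subst; lia.
  have [k [y1 [y2 [y3 ek]]] E'] := Hg gA PA.
  by have := two x1 (x2 + b2) x3 (y1 + a1) y2 y3; subst; lia.
have [_ Hadd] := submonoid_combinations n1 n2 n3.
have inA x1 x2 x3 y1 y2 y3 :
    x1 * n1 + x2 * n2 + x3 * n3 + gB = gA + (y1 * n1 + y2 * n2 + y3 * n3) ->
    trace_exponents (combinations n1 n2 n3) (x1 * n1 + x2 * n2 + x3 * n3).
  move=> E; exists gB => // g /PFE[] Eg.
    by exists (y1 * n1 + y2 * n2 + y3 * n3); [exact: combinationsE|lia].
  by exists (x1 * n1 + x2 * n2 + x3 * n3); [exact: combinationsE|lia].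
have inB x1 x2 x3 y1 y2 y3 :
    x1 * n1 + x2 * n2 + x3 * n3 + gA = gB + (y1 * n1 + y2 * n2 + y3 * n3) ->
    trace_exponents (combinations n1 n2 n3) (x1 * n1 + x2 * n2 + x3 * n3).
  move=> E; exists gA => // g /PFE[] Eg.
    by exists (x1 * n1 + x2 * n2 + x3 * n3); [exact: combinationsE|lia].
  by exists (y1 * n1 + y2 * n2 + y3 * n3); [exact: combinationsE|lia].
move=> [x1 [x2 [x3 [-> ]]]]; rewrite !geq_min.
move=> -[] /orP[] /leq_exists_addn[k e].
(* The six cases use gA - gB = a1 n1 - b2 n2 = a2 n2 - b3 n3 = a3 n3 - b1 n1: the available a_i n_i
   or b_i n_i is exchanged for its partner. *)
- by apply: (inA x1 x2 x3 k (x2 + b2) x3); subst; lia.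
- by apply: (inB x1 x2 x3 k x2 (x3 + a3)); subst; lia.
- by apply: (inA x1 x2 x3 x1 k (x3 + b3)); subst; lia.
- by apply: (inB x1 x2 x3 (x1 + a1) k x3); subst; lia.
- by apply: (inA x1 x2 x3 (x1 + b1) x2 k); subst; lia.
- by apply: (inB x1 x2 x3 x1 (x2 + a2) k); subst; lia.
Qed.

End Combinatorics.

(** * Monomial subspaces of K(t) *)

Section MonomialModules.
Variable K : fieldType.
Implicit Types (H S : set nat) (p q : {poly K}).

Definition supported_on (S : set nat) (p : {poly K}) : Prop :=
  forall i, p`_i != 0 -> S i.

(** The K-span of the t^s with s in S, described through polynomials so that membership is read off
    coefficients. *)
Definition monomial_span (S : set nat) : set (ratfun K) :=
  @tofrac _ @` supported_on S.

Lemma supported_on0 S : supported_on S 0.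
Proof. by move=> i; rewrite coef0 eqxx. Qed.

Lemma supported_onZD S c p q :
  supported_on S p -> supported_on S q -> supported_on S (c *: p + q).
Proof.
move=> Sp Sq i; rewrite coefD coefZ => nz.
have [q0|/Sq//] := eqVneq q`_i 0; apply: Sp; apply: contra_neq nz => ->.
by rewrite mulr0 q0 addr0.
Qed.

Lemma supported_onM H S p q :
  (forall h s, H h -> S s -> S (h + s)%N) ->
  supported_on H p -> supported_on S q -> supported_on S (p * q).
Proof.
move=> HS Hp Sq i; rewrite coefM => nz; apply: contrapT => nSi.
case/eqP: nz; apply: big1 => j _; apply/eqP; rewrite mulf_eq0.
apply: contra_notT nSi; rewrite negb_or => /andP[/Hp Hj /Sq Sj].
by have := HS _ _ Hj Sj; rewrite subnKC // -ltnS.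
Qed.

Lemma supported_onXn S s : S s -> supported_on S 'X^s.
Proof.
by move=> Ss i; rewrite coefXn; case: (i =P s) => [->|_] //; rewrite mulr0n eqxx.
Qed.

Lemma monomial_span_tvar S s : S s -> monomial_span S (tvar ^+ s).
Proof.
by move=> Ss; exists 'X^s; rewrite ?tofracXn //; apply: supported_onXn.
Qed.

Lemma monomial_span_kconst S c : S 0%N -> monomial_span S (kconst c).
Proof.
by move=> S0; exists c%:P => // i; rewrite coefC;
  case: (i =P 0%N) => [->|_] //; rewrite eqxx.
Qed.

Lemma submodule_monomial_span H S :
  (forall h s, H h -> S s -> S (h + s)%N) ->
  submodule (monomial_span H) (monomial_span S).
Proof.
move=> HS; split.
- by exists 0; [exact: supported_on0 | exact: tofrac0].
- move=> _ _ [p Sp <-] [q Sq <-]; exists (p + q); last exact: tofracD.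
  by rewrite -[p]scale1r; apply: supported_onZD.
- move=> _ _ [p Hp <-] [q Sq <-]; exists (p * q); last exact: tofracM.
  exact: supported_onM Hp Sq.
Qed.

Lemma submodule_sum R N n (F : 'I_n -> ratfun K) :
  submodule R N -> (forall i, N (F i)) -> N (\sum_(i < n) F i).
Proof.
move=> [N0 ND _] NF; elim: n F NF => [|n IHn] F NF; first by rewrite big_ord0.
by rewrite big_ord_recr /=; apply: ND; first apply: IHn.
Qed.

Lemma tofrac_poly p :
  tofrac p = \sum_(i < size p) kconst p`_i * tvar ^+ i :> ratfun K.
Proof.
rewrite -[in LHS](coefK p) poly_def (big_morph _ (@tofracD _) (@tofrac0 _));
  apply: eq_bigr => i _.
by rewrite -mul_polyC tofracM tofracXn.
Qed.

Lemma monomial_span_sub H S (N : set (ratfun K)) :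
  H 0%N -> submodule (monomial_span H) N ->
  (forall s, S s -> N (tvar ^+ s)) -> monomial_span S `<=` N.
Proof.
move=> H0 Nmod NS _ [p Sp <-]; rewrite tofrac_poly.
apply: submodule_sum (Nmod) _ => i; case: Nmod => N0 _ NM.
have [->|/Sp/NS Ni] := eqVneq p`_i 0; first by rewrite /kconst tofrac0 mul0r.
by apply: NM => //; apply: monomial_span_kconst.
Qed.

Lemma semigroup_ringE H : submonoid H -> semigroup_ring K H = monomial_span H.
Proof.
move=> [H0 HD]; congr (_ @` _); apply/seteqP; split.
  apply: smallest_sub; last by move=> _ [h Hh <-]; apply: supported_onXn.
  split.
  - by rewrite inE -(expr0 'X); apply: supported_onXn.
  - by move=> c p q; rewrite !inE; apply: supported_onZD.
  - by move=> p q; rewrite !inE; apply: supported_onM.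
move=> p Hp A [[A1 AZ AM] sA].
(* Closure as a subalgebra provides 1 and linear combinations, so 0 is obtained as -1 + 1. *)
have A0 : A 0.
  have := AZ (-1) 1 1; rewrite scaleN1r addNr => /(_ A1 A1).
  by rewrite inE.
rewrite -(coefK p) poly_def; elim: (size p) => [|n IHn];
  first by rewrite big_ord0.
rewrite big_ord_recr /= addrC.
have [->|/Hp Hn] := eqVneq p`_n 0; first by rewrite scale0r add0r.
have := AZ p`_n 'X^n (\sum_(i < n) p`_i *: 'X^i); rewrite !inE; apply=> //.
by apply: sA; exists n.
Qed.

Lemma submodule_module_span R (G : set (ratfun K)) :
  submodule R (module_span R G).
Proof.
split.
- by move=> N [[]].
- by move=> x y Nx Ny N [Nm sG]; case: (Nm) => _ ND _; apply: ND;
    [apply: Nx|apply: Ny].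
- by move=> r x Rr Nx N [Nm sG]; case: (Nm) => _ _ NM; apply: NM;
    last apply: Nx.
Qed.

(** * The trace of the canonical module *)

Lemma tvar_neq0 : tvar != 0 :> ratfun K.
Proof. by rewrite tofrac_eq0 polyX_eq0. Qed.

Lemma tvarX_neq0 n : tvar ^+ n != 0 :> ratfun K.
Proof. by rewrite expf_neq0 // tvar_neq0. Qed.

(** For s in T with witness g, multiplication by t^(s+g) is a homomorphism sending t^-g to t^s.
    Conversely, a homomorphism is multiplication by some c, and since every c t^-g' lies in R, the
    exponents of c t^-g lie in T. *)
Lemma trace_canonical_module H :
  submonoid H -> (exists2 m, H m & m <> 0%N) -> pseudo_frobenius H !=set0 ->
  trace (semigroup_ring K H) (canonical_module K H)
    = monomial_span (trace_exponents H).
Proof.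
move=> Hm [m Hmm m0] [f PFf]; have [H0 HD] := Hm.
rewrite /trace /canonical_module semigroup_ringE //.
set R := monomial_span H; set N := module_span R [set _ | f in _].
have HT h s : H h -> trace_exponents H s -> trace_exponents H (h + s)%N.
  exact: trace_exponents_addl.
have Nmod : submodule R N by exact: submodule_module_span.
have Nf g : pseudo_frobenius H g -> N (tvar ^- g).
  by move=> PFg; apply: sub_gen_smallest; exists g.
apply/seteqP; split; last first.
  apply: monomial_span_sub H0 (submodule_module_span _ _) _ => s [g PFg Hg].
  apply: sub_gen_smallest; exists (fun x => tvar ^+ (s + g) * x); last first.
    by exists (tvar ^- g); [exact: Nf | rewrite exprD mulfK ?tvarX_neq0].
  split; last 2 first.
  - by move=> x y _ _; rewrite mulrDr.
  - by move=> r x _ _; rewrite mulrCA.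
  apply: smallest_sub.
    have [R0 RD RM] := submodule_monomial_span HD.
    split=> [|x y Rx Ry|r x Rr Rx].
    - by rewrite mulr0.
    - by rewrite mulrDr; apply: RD.
    - by rewrite mulrCA; apply: RM.
  move=> _ [g' /Hg[k Hk ->] <-].
  rewrite exprD mulrAC mulfV ?tvarX_neq0 // mul1r; exact: monomial_span_tvar.
have Tmod := submodule_monomial_span HT; have [T0 TD TM] := Tmod.
apply: smallest_sub => // _ [phi [phiR phiD phiM] [x Nx <-]].
(* [phi] is multiplication by [c], because [omega] has rank one. *)
pose c := phi (tvar ^- f) * tvar ^+ f.
have phiE y : N y -> phi y = c * y.
  (* Membership in N is carried through the induction because phi is linear only there. *)
  move=> Ny; have [_] : N y /\ phi y = c * y; last by [].
  have [N0 ND NM] := Nmod.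
  have phi0 : phi 0 = 0 by apply: (@addrI _ (phi 0)); rewrite -phiD // !addr0.
  move: y Ny; apply: smallest_sub.
    split=> [|y z [Ny Ey] [Nz Ez]|r y Rr [Ny Ey]].
    - by rewrite phi0 mulr0.
    - by split; [exact: ND | rewrite phiD // Ey Ez mulrDr].
    - by split; [exact: NM | rewrite phiM // Ey mulrCA].
  move=> _ [g PFg <-]; split; first exact: Nf.
  (* Both t^(g+m) t^-g and t^(f+m) t^-f equal t^m, with first factors in R; linearity thus links phi
     at t^-g to phi at t^-f. *)
  have Rg : R (tvar ^+ (g + m)) by apply: monomial_span_tvar;
    case: PFg => _; apply.
  have Rf : R (tvar ^+ (f + m)) by apply: monomial_span_tvar;
    case: PFf => _; apply.
  apply: (mulfI (tvarX_neq0 (g + m))).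
  rewrite -phiM //; last exact: Nf.
  have -> : tvar ^+ (g + m) * tvar ^- g =
      tvar ^+ (f + m) * tvar ^- f :> ratfun K.
    by rewrite !exprD !(mulrAC _ (tvar ^+ m)) !mulfV ?tvarX_neq0.
  rewrite phiM //; last exact: Nf.
  rewrite /c !exprD [RHS]mulrC !mulrA mulfVK ?tvarX_neq0 //.
  by rewrite [LHS]mulrC mulrA.
rewrite phiE //; have Pf g : pseudo_frobenius H g -> R (c * tvar ^- g).
  by move=> PFg; rewrite -phiE; [apply: phiR|]; apply: Nf.
move: x Nx; apply: smallest_sub.
  split=> [|y z Ty Tz|r y Rr Ty].
  - by rewrite mulr0.
  - by rewrite mulrDr; apply: TD.
  - by rewrite mulrCA; apply: TM.
move=> _ [g PFg <-]; have [p Hp pE] := Pf g PFg.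
rewrite -pE; exists p => // s ps; exists g => // g' PFg'.
(* Both p t^g and q t^g' equal c. A nonzero coefficient of p at s is the one of q at s + g - g',
   which is therefore in H. *)
have [q Hq qE] := Pf g' PFg'.
have E : p * 'X^g = q * 'X^g'.
  apply/eqP; rewrite -tofrac_eq !tofracM !tofracXn pE qE.
  by rewrite !divfK ?tvarX_neq0.
have := congr1 (fun r : {poly K} => r`_(s + g)) E.
rewrite coefMXn ltnNge leq_addl /= addnK coefMXn.
case: ltnP => [_ /eqP|le qs]; first by rewrite (negbTE ps).
by exists (s + g - g')%N; [apply: Hq; rewrite -qs | lia].
Qed.

(** * Dimension of a quotient of monomial spans *)

(** The classes of the t^(e i) form a basis, since the coefficient at e i recovers the i-th
    coordinate. A general finite index type admits a box of triples directly. *)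
Lemma quotient_dim_monomial_span S T (I : finType) (e : I -> nat) :
  injective e -> T `<=` S -> (forall i, S (e i) /\ ~ T (e i)) ->
  (forall s, S s -> ~ T s -> exists i, e i = s) ->
  quotient_dim (monomial_span S) (monomial_span T) #|I|.
Proof.
move=> e_inj TS eST eP.
pose comb (c : 'I_#|I| -> K) : {poly K} :=
  \sum_(i < #|I|) c i *: 'X^(e (enum_val i)).
have combE c : \sum_(i < #|I|) kconst (c i) * tvar ^+ e (enum_val i)
    = tofrac (comb c) :> ratfun K.
  rewrite (big_morph _ (@tofracD _) (@tofrac0 _)); apply: eq_bigr => i _.
  by rewrite -mul_polyC tofracM tofracXn.
have coef_comb c i : (comb c)`_(e (enum_val i)) = c i.
  rewrite coef_sum (bigD1 i) //= coefZ coefXn eqxx mulr1 big1 ?addr0 // => j ji.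
  rewrite coefZ coefXn (inj_eq e_inj) (inj_eq enum_val_inj) eq_sym (negbTE ji).
  by rewrite mulr0.
have coef_comb0 c s : (forall i, e i != s) -> (comb c)`_s = 0.
  move=> nes; rewrite coef_sum big1 // => i _.
  by rewrite coefZ coefXn eq_sym (negbTE (nes _)) mulr0.
exists (fun i => tvar ^+ e (enum_val i)); split.
- by move=> i; apply: monomial_span_tvar; case: (eST (enum_val i)).
- move=> c; rewrite combE => -[p Tp /eqP]; rewrite tofrac_eq => /eqP E i.
  rewrite -coef_comb -E; apply/eqP; apply: contrapT => /negP /Tp.
  by case: (eST (enum_val i)).
move=> _ [p Sp <-]; exists (fun i => p`_(e (enum_val i))).
rewrite combE -tofracB.
exists (p - comb (fun i => p`_(e (enum_val i)))) => // s.
apply: contra_neqP => nTs; rewrite coefB.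
have [[i <-]|ne] := pselect (exists i, e i = s).
  by rewrite -(enum_rankK i) coef_comb subrr.
rewrite coef_comb0 ?subr0; last by move=> i; apply/eqP => ei; apply: ne;
  exists i.
by apply/eqP; apply: contrapT => /negP /Sp Ss; apply/ne/eP.
Qed.

End MonomialModules.

(** * Generators of the trace and the residue *)

Theorem proposition2p1 (K : fieldType) (H : set nat) (n1 n2 n3 : nat)
    (H_numerical : numerical_semigroup H)
    (n_distinct : uniq [:: n1; n2; n3])
    (H_generated : minimally_generates [set n1; n2; n3] H)
    (H_nonsymmetric : ~ symmetric_semigroup H)
    (a1 a2 a3 b1 b2 b3 c1 c2 c3 : nat)
    (c1_least : least_multiple c1 n1 [set n2; n3])
    (c2_least : least_multiple c2 n2 [set n1; n3])
    (c3_least : least_multiple c3 n3 [set n1; n2])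
    (rel1 : (c1 * n1 = b2 * n2 + a3 * n3)%N)
    (rel2 : (c2 * n2 = a1 * n1 + b3 * n3)%N)
    (rel3 : (c3 * n3 = b1 * n1 + a2 * n2)%N) :
  let R := semigroup_ring K H in
  let d1 := minn a1 b1 in
  let d2 := minn a2 b2 in
  let d3 := minn a3 b3 in
  trace R (canonical_module K H) =
    module_span R [set tvar ^+ (d1 * n1); tvar ^+ (d2 * n2); tvar ^+ (d3 * n3)]
  /\ residue K H (d1 * d2 * d3)%N.
Proof.
have [p1 p2 p3] := minimally_generates_gt0 n_distinct H_generated.
have HE : H = combinations n1 n2 n3 by rewrite -monoid_span3; case: H_generated.
have h : herzog n1 n2 n3 a1 a2 a3 b1 b2 b3 c1 c2 c3.
  have [q1 _ _] := c1_least; have [q2 _ _] := c2_least;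
    have [q3 _ _] := c3_least.
  split=> //; last 1 first.
  - by rewrite rel2 addnC.
  - exact: least_multiple_minimal.
  - by apply: minimal_coefC; apply: least_multiple_minimal.
  - exact: least_multiple_minimal.
case: H_numerical => Hm Hcofin.
have [a_gt0 b_gt0] :
    [/\ 0 < a1, 0 < a2 & 0 < a3]%N /\ [/\ 0 < b1, 0 < b2 & 0 < b3]%N.
  rewrite HE in H_nonsymmetric Hcofin.
  (* Relabelling the generators brings each coincidence to the form c3 n3 = c1 n1. *)
  apply: (herzog_coef_gt0 h) => E; apply: H_nonsymmetric.
  - rewrite combinations_swap in Hcofin *.
    exact: (coincidence_symmetric (herzog_swap h)).
  - rewrite -combinations_rot in Hcofin *.
    exact: (coincidence_symmetric (herzog_rot (herzog_rot h))).
  - exact: (coincidence_symmetric h).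
have TE := trace_exponents_herzog h a_gt0 b_gt0.
rewrite -HE in TE; set T := trace_exponents H in TE.
move=> R d1 d2 d3.
have Hx x1 x2 x3 : H (x1 * n1 + x2 * n2 + x3 * n3)%N by rewrite HE;
  exists x1, x2, x3.
have T1 : T (d1 * n1)%N by rewrite TE; exists d1, 0%N, 0%N; split;
  [lia | constructor 1].
have T2 : T (d2 * n2)%N by rewrite TE; exists 0%N, d2, 0%N; split;
  [lia | constructor 2].
have T3 : T (d3 * n3)%N by rewrite TE; exists 0%N, 0%N, d3; split;
  [lia | constructor 3].
(* Membership in T supplies a pseudo-Frobenius number, so [pseudo_frobenius H] is nonempty. *)
have [f PFf _] := T1.
have trE : trace R (canonical_module K H) = @monomial_span K T.
  apply: trace_canonical_module => //; last by exists f.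
  by exists n1; [have := Hx 1%N 0%N 0%N; rewrite mul1n !addn0 | lia].
have RE : R = monomial_span H by exact: semigroup_ringE.
rewrite /residue trE; split.
  apply/seteqP; split; last first.
    apply: smallest_sub; first rewrite RE.
      by apply: submodule_monomial_span => x y; apply: trace_exponents_addl.
    by move=> _ [[->|->]|->]; apply: monomial_span_tvar.
  set G : set (ratfun K) := [set _; _; _].
  have := submodule_module_span R G; rewrite RE => Gmod.
  apply: (monomial_span_sub (H := H)) => //; first by case: Hm.
  have gen d k : H k -> G (tvar ^+ d) ->
      module_span (@monomial_span K H) G (tvar ^+ (k + d)).
    move=> Hk Gd; rewrite exprD; case: Gmod => _ _; apply.
      exact: monomial_span_tvar.
    exact: sub_gen_smallest.
  move=> s; rewrite TE => -[x1 [x2 [x3 [-> [] /leq_exists_addn[k ->]]]]].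
  - have -> : ((d1 + k) * n1 + x2 * n2 + x3 * n3 =
        (k * n1 + x2 * n2 + x3 * n3) + d1 * n1)%N by lia.
    by apply: gen; [exact: Hx | left; left].
  - have -> : (x1 * n1 + (d2 + k) * n2 + x3 * n3 =
        (x1 * n1 + k * n2 + x3 * n3) + d2 * n2)%N by lia.
    by apply: gen; [exact: Hx | left; right].
  - have -> : (x1 * n1 + x2 * n2 + (d3 + k) * n3 =
        (x1 * n1 + x2 * n2 + k * n3) + d3 * n3)%N by lia.
    by apply: gen; [exact: Hx | right].
rewrite -/R RE.
pose e (i : 'I_d1 * 'I_d2 * 'I_d3) := (i.1.1 * n1 + i.1.2 * n2 + i.2 * n3)%N.
have box := box_factorization_unique h a_gt0 b_gt0.
have -> : (d1 * d2 * d3)%N = #|{: 'I_d1 * 'I_d2 * 'I_d3}|.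
  by rewrite !card_prod !card_ord.
apply: (@quotient_dim_monomial_span _ _ _ _ e).
- move=> [[i1 i2] i3] [[j1 j2] j3] E.
  have [] := box _ _ _ _ _ _ (ltn_ord i1) (ltn_ord i2) (ltn_ord i3) E.
  by move=> /ord_inj-> [/ord_inj-> /ord_inj->].
- by rewrite TE HE => _ [x1 [x2 [x3 [-> _]]]]; exists x1, x2, x3.
- move=> [[i1 i2] i3]; split; first exact: Hx.
  rewrite TE => -[x1 [x2 [x3 [E]]]].
  have [<- [<- <-]] := box _ _ _ _ _ _ (ltn_ord i1) (ltn_ord i2) (ltn_ord i3) E.
  by case; rewrite leqNgt ltn_ord.
rewrite HE TE => _ [x1 [x2 [x3 ->]]] nT.
have l1 : (x1 < d1)%N.
  by rewrite ltnNge; apply/negP => l; apply: nT; exists x1, x2, x3;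
    split=> //; constructor 1.
have l2 : (x2 < d2)%N.
  by rewrite ltnNge; apply/negP => l; apply: nT; exists x1, x2, x3;
    split=> //; constructor 2.
have l3 : (x3 < d3)%N.
  by rewrite ltnNge; apply/negP => l; apply: nT; exists x1, x2, x3;
    split=> //; constructor 3.
by exists (Ordinal l1, Ordinal l2, Ordinal l3).
Qed.
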